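(* Let $f_1,\ldots,f_l\in\mathbb{C}[x_1,\ldots,x_m]$ have finitely many common roots in $\mathbb{C}^m$, let $I$ be the ideal they generate, let $A=\mathbb{C}[x_1,\ldots,x_m]/I$ with $n=\dim_{\mathbb{C}}A$, and let $B=[b_1,\ldots,b_n]$ be a basis of $A$. Let $\{\mathbf{z}_1,\ldots,\mathbf{z}_n\}\subset\mathbb{C}^m$ be the common roots of $f_1,\ldots,f_l$ (not necessarily distinct, each listed as many times as its multiplicity). Then the matrix of traces $R=[Tr(M_{b_ib_j})]_{i,j=1}^n$ with respect to $B$ satisfies $$R=\left[\sum_{k=1}^n b_ib_j(\mathbf{z}_k)\right]_{i,j=1}^n,$$ where $b_ib_j(\mathbf{z}_k)$ is the evaluation of the polynomial $b_ib_j$ at the point $\mathbf{z}_k$.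
   Context: For $g\in A$, $M_g$ denotes the matrix of the multiplication map $A\to A$, $h\mapsto gh$, in the basis $B$, and $Tr$ denotes the trace of a matrix. The elements $b_1,\ldots,b_n$ of $A$ and some fixed preimages of them in $\mathbb{C}[x_1,\ldots,x_m]$ are denoted by the same symbols. The multiplicity of a common root $\mathbf{z}$ is $\dim_{\mathbb{C}}\mathbb{C}[x_1,\ldots,x_m]/Q$, where $Q$ is the primary component of $I$ whose radical is the ideal of all polynomials vanishing at $\mathbf{z}$. *)

(* Defs.v *)
From HB Require Import structures.
From mathcomp Require Import all_boot all_order all_algebra ring_quotient.
From mathcomp Require Import boolp classical_sets.
From mathcomp Require Import mpoly.

Set Implicit Arguments.
Unset Strict Implicit.
Unset Printing Implicit Defensive.

Import GRing.Theory.
Local Open Scope ring_scope.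
Local Open Scope quotient_scope.

(* The ideals of ring_quotient (idealr) are proper, whereas the ideal generated
   by polynomials without common root is the unit ideal. *)
Record ideal (R : comNzRingType) := Ideal {
  ideal_pred :> {pred R};
  ideal_closed : submod_closed (ideal_pred : {pred R^o})
}.

Section IdealTheory.
Variables (R : comNzRingType) (I : ideal R).

Lemma ideal_zmod_closed : zmod_closed I.
Proof.
have [I0 Ilin] := ideal_closed I; split=> // x y Ix Iy.
by have := Ilin (- 1) y x Iy Ix; rewrite scaleN1r addrC.
Qed.

HB.instance Definition _ :=
  GRing.isZmodClosed.Build R (ideal_pred I) ideal_zmod_closed.

Definition ideal_zmodClosed : zmodClosed R :=
  GRing.ZmodClosed.clone R (ideal_pred I) _.

Lemma idealM (a u : R) : u \in I -> a * u \in I.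
Proof.
have [I0 Ilin] := ideal_closed I => Iu.
by have := Ilin a u 0 Iu I0; rewrite addr0.
Qed.

End IdealTheory.

(* As I may be the unit ideal, the quotient P / I is only a possibly
   zero commutative ring, together with a structure of F-module; the algebra
   structures of the library are restricted to nonzero rings. *)
Section Quotient.
Variables (F : fieldType) (P : comAlgType F) (I : ideal P).

Definition quotient : Type := {ideal_quot ideal_zmodClosed I}.

HB.instance Definition _ := GRing.Zmodule.on quotient.
HB.instance Definition _ := EqQuotient.on quotient.

Definition qproj : P -> quotient := \pi_quotient.

Lemma qprojP (x y : P) : (qproj x = qproj y) <-> (x - y \in I).
Proof.
by split=> [xy|]; [rewrite Quotient.idealrBE; apply/eqP
                  |rewrite Quotient.idealrBE => /eqP].
Qed.

Lemma qprojK (a : quotient) : qproj (repr a) = a.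
Proof. exact: reprK. Qed.

Lemma qproj_is_additive : zmod_morphism qproj.
Proof. by move=> x y; rewrite /qproj raddfB. Qed.
HB.instance Definition _ :=
  GRing.isZmodMorphism.Build P quotient qproj qproj_is_additive.

Definition qone : quotient := qproj 1.
Definition qmul (a b : quotient) : quotient := qproj (repr a * repr b).
Definition qscale (k : F) (a : quotient) : quotient := qproj (k *: repr a).

Lemma qmulE x y : qmul (qproj x) (qproj y) = qproj (x * y).
Proof.
apply/qprojP; set x' := repr _; set y' := repr _.
have Ix : x' - x \in I by apply/qprojP; rewrite qprojK.
have Iy : y' - y \in I by apply/qprojP; rewrite qprojK.
have -> : x' * y' - x * y = y' * (x' - x) + x * (y' - y).
  by rewrite !mulrBr (mulrC y' x) addrA subrK mulrC.
by rewrite rpredD // idealM.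
Qed.

Lemma qscaleE k x : qscale k (qproj x) = qproj (k *: x).
Proof.
apply/qprojP; set x' := repr _.
have Ix : x' - x \in I by apply/qprojP; rewrite qprojK.
by rewrite -scalerBr -mulr_algl idealM.
Qed.

Lemma qmulA : associative qmul.
Proof.
by move=> a b c; rewrite -(qprojK a) -(qprojK b) -(qprojK c) !qmulE mulrA.
Qed.
Lemma qmulC : commutative qmul.
Proof. by move=> a b; rewrite -(qprojK a) -(qprojK b) !qmulE mulrC. Qed.
Lemma qmul1 : left_id qone qmul.
Proof. by move=> a; rewrite -(qprojK a) qmulE mul1r. Qed.
Lemma qmulD : left_distributive qmul +%R.
Proof.
move=> a b c; rewrite -(qprojK a) -(qprojK b) -(qprojK c).
by rewrite -raddfD !qmulE mulrDl raddfD.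
Qed.
HB.instance Definition _ :=
  GRing.Zmodule_isComPzRing.Build quotient qmulA qmulC qmul1 qmulD.

Lemma qscaleA k k' a : qscale k (qscale k' a) = qscale (k * k') a.
Proof. by rewrite -(qprojK a) !qscaleE scalerA. Qed.
Lemma qscale1 : left_id 1 qscale.
Proof. by move=> a; rewrite -(qprojK a) qscaleE scale1r. Qed.
Lemma qscaleDr : right_distributive qscale +%R.
Proof.
move=> k a b; rewrite -(qprojK a) -(qprojK b) -raddfD !qscaleE.
by rewrite scalerDr raddfD.
Qed.
Lemma qscaleDl a : {morph qscale^~ a : k k' / k + k'}.
Proof. by move=> k k' /=; rewrite -(qprojK a) !qscaleE scalerDl raddfD. Qed.
HB.instance Definition _ := GRing.Zmodule_isLmodule.Build F quotient
  qscaleA qscale1 qscaleDr qscaleDl.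

Lemma qproj_is_multiplicative : monoid_morphism qproj.
Proof. by split=> // x y; rewrite -qmulE. Qed.
HB.instance Definition _ :=
  GRing.isMonoidMorphism.Build P quotient qproj qproj_is_multiplicative.

Lemma qproj_is_scalable : scalable qproj.
Proof. by move=> k x; rewrite -qscaleE. Qed.
HB.instance Definition _ :=
  GRing.isScalable.Build F P quotient *:%R qproj qproj_is_scalable.

End Quotient.

Section Bases.
Variables (F : fieldType) (V : lmodType F).

Definition is_basis n (b : 'I_n -> V) : Prop :=
  (forall v, exists c : 'I_n -> F, v = \sum_i c i *: b i) /\
  (forall c : 'I_n -> F, \sum_i c i *: b i = 0 -> forall i, c i = 0).

Definition has_dim (d : nat) : Prop := exists b : 'I_d -> V, is_basis b.

(* Only meaningful when b is a basis; the coordinates are then unique. *)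
Definition coordinates n (b : 'I_n -> V) (v : V) : 'cV[F]_n :=
  xget 0 [set c : 'cV[F]_n | v = \sum_i c i 0 *: b i]%classic.

End Bases.

Definition mult_matrix (F : fieldType) (P : comAlgType F) (I : ideal P)
    n (b : 'I_n -> quotient I) (g : quotient I) : 'M[F]_n :=
  \matrix_(i, j) coordinates b (g * b j) i 0.

Section PrimaryDecomposition.
Variable R : comNzRingType.
Implicit Types I Q : ideal R.

Definition radical I : set R := [set p | exists k : nat, p ^+ k \in I]%classic.

Definition primary Q : Prop :=
  1 \notin Q /\
  forall p q, p * q \in Q -> p \in Q \/ exists k : nat, q ^+ k \in Q.

Definition minimal_primary_decomposition I r (Q : 'I_r -> ideal R) : Prop :=
  [/\ forall i, primary (Q i),
      forall p, p \in I <-> forall i, p \in Q i,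
      injective (fun i => radical (Q i))
    & forall i, exists2 p, (forall j, j != i -> p \in Q j) & p \notin Q i].

Definition primary_component I Q : Prop :=
  exists (r : nat) (D : 'I_r -> ideal R),
    minimal_primary_decomposition I D /\ exists i, D i = Q.

End PrimaryDecomposition.

Section Polynomials.
Variables (F : fieldType) (m : nat).
Local Notation P := {mpoly F[m]}.
Local Notation point := {ffun 'I_m -> F}.

Section Generated.
Variables (l : nat) (f : 'I_l -> P).

Definition common_roots : set point :=
  [set z | forall i, (f i).@[z] = 0]%classic.

Definition generated_pred (p : P) : bool :=
  `[< exists c : 'I_l -> P, p = \sum_i c i * f i >].

Lemma generated_closed : submod_closed (generated_pred : {pred P^o}).
Proof.
split=> [|a u v /asboolP[c ->] /asboolP[d ->]].
  apply/asboolP; exists (fun=> 0).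
  by rewrite big1 // => i _; rewrite mul0r.
apply/asboolP; exists (fun i => a * c i + d i).
rewrite -[a *: _]/(a * _) mulr_sumr -big_split /=.
by apply: eq_bigr => i _; rewrite mulrDl mulrA.
Qed.

Definition generated_ideal : ideal P := Ideal generated_closed.

End Generated.

Definition vanishing_ideal (z : point) : set P :=
  [set p | p.@[z] = 0]%classic.

(* A relation, because primary decompositions are not unique a priori. *)
Definition has_multiplicity (I : ideal P) (z : point) (mu : nat) : Prop :=
  exists Q : ideal P,
    [/\ primary_component I Q, radical Q = vanishing_ideal z
      & has_dim (quotient Q) mu].

End Polynomials.

(* Main.v *)
Require Import Defs.
From mathcomp Require Import all_boot all_order all_algebra.
From mathcomp Require Import boolp classical_sets cardinality reals complex mpoly.

(* Since A is finite-dimensional over an algebraically closed field, every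
   component Q_w of a minimal primary decomposition of I has the vanishing ideal
   of a common root w as radical, and hence is isolated: p lies in Q_w if and
   only if q * p lies in I for some q with q(w) != 0. So the components do not
   depend on the decomposition. Let the e_w be the orthogonal idempotents of
   A = \prod_w P / Q_w. As (g - g(w)) e_w is nilpotent in A, the trace of
   multiplication by g = \sum_w g e_w is \sum_w g(w) Tr(M_(e_w)), and
   Tr(M_(e_w)) is the dimension of P / Q_w, the multiplicity of w. *)

Set Implicit Arguments.
Unset Strict Implicit.
Unset Printing Implicit Defensive.

Import GRing.Theory.
Local Open Scope ring_scope.
Local Open Scope complex_scope.

(** * Trace of a nilpotent matrix *)

Lemma mxtrace_nilpotent (F : closedFieldType) (n : nat) (A : 'M[F]_n) (k : nat) :
  A ^+ k = 0 -> \tr A = 0.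
Proof.
case: n A => [|n] A Ak0; first by rewrite /mxtrace big_ord0.
have [r] := closed_field_poly_normal (char_poly A).
rewrite (monicP (char_poly_monic A)) scale1r => rE.
(* Each root [a] is an eigenvalue, and [A ^+ k = 0] forces [a ^+ k = 0]. So the characteristic
   polynomial is a power of ['X]. *)
have r0 : all (pred1 0) r.
  apply/allP => a ra /=.
  have /eigenvalueP[v vA v0] : eigenvalue A a.
    by rewrite eigenvalue_root_char rE root_prod_XsubC.
  have vAk j : v *m A ^+ j = a ^+ j *: v.
    elim: j => [|j IHj]; first by rewrite expr0 mulmx1 scale1r.
    by rewrite exprSr mulmxA IHj -scalemxAl vA scalerA -exprSr.
  have := vAk k; rewrite Ak0 mulmx0 => /esym/eqP.
  by rewrite scaler_eq0 (negPf v0) orbF expf_eq0 => /andP[].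
have {}rE : char_poly A = 'X^(size r).
  by rewrite rE (all_pred1P _ _ r0) big_nseq size_nseq subr0 iter_mulr_1.
have rn : size r = n.+1 by move: (size_char_poly A); rewrite rE size_polyXn => -[].
have := char_poly_trace (n := n.+1) A isT.
by rewrite rE rn coefXn /= ltn_eqF // => /esym/eqP; rewrite oppr_eq0 => /eqP.
Qed.

(** * Radicals and primary ideals *)

Section Ideals.
Variables (P : comNzRingType).
Implicit Types I : ideal P.

Lemma ideal_exp I (u : P) (k : nat) : (0 < k)%N -> u \in I -> u ^+ k \in I.
Proof. by case: k => // k _ Iu; rewrite exprSr idealM. Qed.

Lemma radicalM I (a u : P) : radical I u -> radical I (a * u).
Proof. by case=> k Iuk; exists k; rewrite exprMn idealM. Qed.

Lemma radicalD I (x y : P) : radical I x -> radical I y -> radical I (x + y).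
Proof.
case=> a Ix [b Iy]; exists (a + b)%N; rewrite exprDn; apply: rpred_sum => i _.
apply: rpredMn; have [lei|lti] := leqP i b.
  by rewrite -addnBA // addnC exprD mulrAC idealM.
by rewrite -(subnK (ltnW lti)) [y ^+ _]exprD mulrA idealM.
Qed.

Lemma radical0 I : radical I 0.
Proof. by exists 1; rewrite expr1 rpred0. Qed.

Lemma primary_radical_prod I (T : eqType) (r : seq T) (x : T -> P) :
  primary I -> \prod_(a <- r) x a \in I -> exists a, radical I (x a).
Proof.
case=> I1 Iprim; elim: r => [|a r IHr]; first by rewrite big_nil (negPf I1).
by rewrite big_cons mulrC => /Iprim[/IHr|] //; exists a.
Qed.

End Ideals.

(** * Coordinates and quotient algebras *)

Section Bases.
Variables (F : fieldType) (V : lmodType F) (n : nat) (b : 'I_n -> V).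
Hypothesis b_basis : is_basis b.

Lemma coordinatesE (v : V) : v = \sum_i coordinates b v i 0 *: b i.
Proof.
have [c vE] := b_basis.1 v; rewrite /coordinates.
apply: (xgetPex 0 (P := [set c : 'cV_n | v = \sum_i c i 0 *: b i]%classic)).
by exists (\col_i c i); rewrite /= vE; apply: eq_bigr => i _; rewrite mxE.
Qed.

Lemma coordinates_unique (v : V) (c : 'I_n -> F) :
  v = \sum_i c i *: b i -> forall i, coordinates b v i 0 = c i.
Proof.
move=> vE i; apply/eqP; rewrite -subr_eq0; apply/eqP; move: i.
apply: b_basis.2; under eq_bigr => i _ do rewrite scalerBl.
by rewrite sumrB -coordinatesE -vE subrr.
Qed.

End Bases.

Section Quotient.
Variables (F : fieldType) (P : comAlgType F) (I : ideal P).
Implicit Types g h : quotient I.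

Lemma qprojZ (c : F) (p : P) : qproj I (c *: p) = c *: qproj I p.
Proof. exact: linearZ. Qed.

Lemma qscaleAl (c : F) g h : c *: (g * h) = (c *: g) * h.
Proof.
by rewrite -(qprojK g) -(qprojK h) -rmorphM -!qprojZ -rmorphM scalerAl.
Qed.

Lemma qscaleAr (c : F) g h : c *: (g * h) = g * (c *: h).
Proof. by rewrite mulrC qscaleAl mulrC. Qed.

Lemma qproj_eq0 (p : P) : qproj I p = 0 <-> p \in I.
Proof. by rewrite -(raddf0 (qproj I)) qprojP subr0. Qed.

End Quotient.

(** * Multiplication matrices and their traces *)

Section MultMatrix.
Variables (F : fieldType) (P : comAlgType F) (I : ideal P).
Implicit Types g h : quotient I.
Variables (n : nat) (B : 'I_n -> quotient I).
Hypothesis B_basis : is_basis B.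
Local Notation M := (mult_matrix B).

Lemma mult_matrixE g j : g * B j = \sum_i M g i j *: B i.
Proof.
rewrite {1}(coordinatesE B_basis (g * B j)).
by apply: eq_bigr => i _; rewrite mxE.
Qed.

Lemma mult_matrix_unique g (A : 'M_n) :
  (forall j, g * B j = \sum_i A i j *: B i) -> M g = A.
Proof.
move=> gE; apply/matrixP => i j; rewrite mxE.
exact: (coordinates_unique B_basis (gE j)).
Qed.

Lemma mult_matrixD g h : M (g + h) = M g + M h.
Proof.
apply: mult_matrix_unique => j; rewrite mulrDl !mult_matrixE -big_split /=.
by apply: eq_bigr => i _; rewrite [in RHS]mxE scalerDl.
Qed.

Lemma mult_matrixZ (c : F) g : M (c *: g) = c *: M g.
Proof.
apply: mult_matrix_unique => j; rewrite -qscaleAl mult_matrixE scaler_sumr.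
by apply: eq_bigr => i _; rewrite [in RHS]mxE scalerA.
Qed.

Lemma mult_matrix0 : M 0 = 0.
Proof. by rewrite -(scale0r 0) mult_matrixZ scale0r. Qed.

Lemma mult_matrix1 : M 1 = 1%:M.
Proof.
apply: mult_matrix_unique => j; rewrite mul1r (bigD1 j) //= mxE eqxx scale1r.
by rewrite big1 ?addr0 // => i /negPf ij; rewrite mxE ij scale0r.
Qed.

Lemma mult_matrixM g h : M (g * h) = M g *m M h.
Proof.
apply: mult_matrix_unique => j; rewrite -mulrA mult_matrixE mulr_sumr.
under eq_bigr => i _ do rewrite -qscaleAr mult_matrixE scaler_sumr.
rewrite exchange_big /=; apply: eq_bigr => k _; rewrite [in RHS]mxE scaler_suml.
by apply: eq_bigr => i _; rewrite scalerA mulrC.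
Qed.

Lemma mult_matrixX g k : M (g ^+ k) = M g ^+ k.
Proof.
by elim: k => [|k IHk]; rewrite ?expr0 ?mult_matrix1 // !exprS mult_matrixM IHk.
Qed.

(** The regular representation is faithful: [g] is the image of 1 under multiplication by [g]. *)
Lemma mult_matrix_eq0 g : M g = 0 -> g = 0.
Proof.
move=> Mg0; have gB j : g * B j = 0.
  by rewrite mult_matrixE big1 // => i _; rewrite Mg0 mxE scale0r.
rewrite -[g]mulr1 (coordinatesE B_basis 1) mulr_sumr big1 // => i _.
by rewrite -qscaleAr gB scaler0.
Qed.

(* Multiplication by e factors as A -> P / Q -> A, where the first map is the
   projection and the second one, multiplication by e, is a section of it. *)
Lemma mxtrace_idempotent (Q : ideal P) (mu : nat) (e : P) :
    (forall p, p \in I -> p \in Q) -> 1 - e \in Q ->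
    (forall p, p \in Q -> e * p \in I) -> has_dim (quotient Q) mu ->
  \tr (M (qproj I e)) = mu%:R.
Proof.
move=> IQ Qe eQ [u u_basis].
pose U := \matrix_(i < n, j < mu) coordinates B (qproj I (e * repr (u j))) i 0.
pose V := \matrix_(i < mu, j < n) coordinates u (qproj Q (repr (B j))) i 0.
have UE j : qproj I (e * repr (u j)) = \sum_i U i j *: B i.
  rewrite {1}(coordinatesE B_basis (qproj _ _)).
  by apply: eq_bigr => i _; rewrite mxE.
have VE j : qproj Q (repr (B j)) = \sum_i V i j *: u i.
  rewrite {1}(coordinatesE u_basis (qproj _ _)).
  by apply: eq_bigr => i _; rewrite mxE.
have MUV : M (qproj I e) = U *m V.
  apply: mult_matrix_unique => j.
  transitivity (\sum_k V k j *: qproj I (e * repr (u k))).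
    rewrite -{1}(qprojK (B j)) -rmorphM.
    under eq_bigr => k _ do rewrite -qprojZ scalerAr.
    rewrite -raddf_sum -mulr_sumr; apply/qprojP; rewrite -mulrBr; apply: eQ.
    apply/qprojP; rewrite VE raddf_sum; apply: eq_bigr => k _.
    by rewrite /= qprojZ qprojK.
  under eq_bigr => k _ do rewrite UE scaler_sumr.
  rewrite exchange_big /=; apply: eq_bigr => i _; rewrite [in RHS]mxE scaler_suml.
  by apply: eq_bigr => k _; rewrite scalerA mulrC.
have VU : V *m U = 1%:M.
  apply/matrixP => k j; have uE : u j = \sum_k (V *m U) k j *: u k.
    transitivity (qproj Q (\sum_i U i j *: repr (B i))).
      transitivity (qproj Q (e * repr (u j))).
        rewrite -{1}(qprojK (u j)); apply/qprojP.
        by rewrite -{1}[repr _]mul1r -mulrBl mulrC idealM.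
      apply/qprojP/IQ/qprojP; rewrite UE raddf_sum; apply: eq_bigr => i _.
      by rewrite /= qprojZ qprojK.
    rewrite raddf_sum.
    under eq_bigr => i _ do rewrite /= qprojZ VE scaler_sumr.
    rewrite exchange_big /=; apply: eq_bigr => i _; rewrite [in RHS]mxE scaler_suml.
    by apply: eq_bigr => l _; rewrite scalerA mulrC.
  rewrite -(coordinates_unique u_basis uE k).
  apply: (coordinates_unique u_basis (c := fun k => 1%:M k j)).
  rewrite (bigD1 j) //= mxE eqxx scale1r big1 ?addr0 // => i /negPf ij.
  by rewrite mxE ij scale0r.
by rewrite MUV mxtrace_mulC VU mxtrace1.
Qed.

End MultMatrix.

Lemma mult_matrix_nilpotent (F : closedFieldType) (P : comAlgType F)
    (I : ideal P) (n : nat) (B : 'I_n -> quotient I) (p : P) :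
  is_basis B -> radical I p -> \tr (mult_matrix B (qproj I p)) = 0.
Proof.
move=> B_basis [k Ipk]; apply: (@mxtrace_nilpotent _ _ _ k).
have pk0 : qproj I p ^+ k = 0 by rewrite -rmorphXn; apply/qproj_eq0.
by rewrite -mult_matrixX // pk0 mult_matrix0.
Qed.

(** The characteristic polynomial of the matrix of [p] splits; Cayley-Hamilton and faithfulness
    carry its vanishing from matrices to the quotient. *)
Lemma quotient_algebraic (F : closedFieldType) (P : comAlgType F)
    (I : ideal P) (n : nat) (B : 'I_n -> quotient I) (p : P) :
  is_basis B -> exists r : seq F, \prod_(a <- r) (p - a%:A) \in I.
Proof.
move=> B_basis; case: n B B_basis => [|n] B B_basis.
  exists [::]; rewrite big_nil; apply/qproj_eq0.
  by rewrite (coordinatesE B_basis (qproj I 1)) big_ord0.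
pose A := mult_matrix B (qproj I p).
have [r] := closed_field_poly_normal (char_poly A).
rewrite (monicP (char_poly_monic A)) scale1r => rE.
exists r; apply/qproj_eq0; apply: (mult_matrix_eq0 B_basis).
rewrite -(Cayley_Hamilton A) rE !rmorph_prod /=.
rewrite (big_morph (mult_matrix B) (mult_matrixM B_basis)
  (mult_matrix1 B_basis)).
apply: eq_bigr => a _; rewrite [in RHS]rmorphB /= horner_mx_X horner_mx_C.
rewrite raddfB /= qprojZ rmorph1 -scaleNr mult_matrixD //= mult_matrixZ //.
by rewrite mult_matrix1 // scaleNr scalemx1.
Qed.

(** * Primary ideals and points *)

Section Points.
Variables (F : closedFieldType) (m : nat).
Local Notation P := {mpoly F[m]}.
Local Notation point := {ffun 'I_m -> F}.
Implicit Types I Q : ideal P.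

Lemma meval_alg (w : point) (c : F) : (c%:A : P).@[w] = c.
Proof. by rewrite mevalZ meval1 mulr1. Qed.

Lemma radical_sub_meval Q (w : point) (p : P) :
    (forall v, radical Q ('X_v - (w v)%:A)) -> radical Q (p - (p.@[w])%:A).
Proof.
(* [S] is closed under products and linear combinations and contains the variables, hence holds
   everywhere. *)
move=> Xw; pose S (g : P) := radical Q (g - (g.@[w])%:A).
have SM g h : S g -> S h -> S (g * h).
  rewrite /S => Sg Sh; rewrite mevalM.
  have -> : g * h - (g.@[w] * h.@[w])%:A =
            h * (g - (g.@[w])%:A) + (g.@[w])%:A * (h - (h.@[w])%:A).
    by rewrite !mulrBr !mulr_algl mulr_algr scalerA (mulrC h) addrA subrK.
  by apply: radicalD; apply: radicalM.
have S1 : S 1 by rewrite /S meval1 scale1r subrr; apply: radical0.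
have SX k : S 'X_[k].
  rewrite mpolyXE_id; elim/big_ind: _ => // v _; elim: (k v) => [|j IHj] //.
  by rewrite exprS; apply: SM => //; rewrite /S mevalXU.
elim/mpolyind: p => [|c k p _ _ Sp].
  by rewrite meval0 scale0r subrr; apply: radical0.
rewrite mevalD mevalZ scalerDl opprD addrACA; apply: radicalD => //.
by rewrite -scalerA -scalerBr -[c *: _]mulr_algl; apply/radicalM/SX.
Qed.

(** Modulo [I] each variable is a root of a split polynomial; as [Q] is primary, one linear factor
    lies in its radical, which gives the coordinate of [w]. *)
Lemma primary_vanishing_ideal I Q n (B : 'I_n -> quotient I) :
    is_basis B -> (forall p, p \in I -> p \in Q) -> primary Q ->
  exists w : point, radical Q = vanishing_ideal w.
Proof.
move=> B_basis IQ Qprim.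
have [w0 Xw0] : exists w : 'I_m -> F, forall v, radical Q ('X_v - (w v)%:A).
  apply: (fin_all_exists (P := fun v c => radical Q ('X_v - c%:A))) => v.
  have [r rI] := quotient_algebraic 'X_v B_basis.
  exact: primary_radical_prod Qprim (IQ _ rI).
pose w : point := finfun w0; exists w.
have {Xw0}Qw p : radical Q (p - (p.@[w])%:A).
  by apply: radical_sub_meval => v; rewrite ffunE.
apply/predeqP => p; split=> [Qp|/= pw]; last by have := Qw p; rewrite pw scale0r subr0.
(* If [p.@[w]] were nonzero, this constant in the radical would put 1 in [Q]. *)
have [k] : radical Q (p.@[w])%:A.
  rewrite -[_%:A](subKr p) addrC; apply: radicalD => //.
  by rewrite -mulN1r; apply: radicalM.
rewrite exprZn expr1n => Qc; apply/eqP; apply: contraT => pw; case/negP: (Qprim.1).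
rewrite -(scale1r 1) -(mulVf (expf_neq0 k pw)) -scalerA -mulr_algl.
exact: idealM.
Qed.

(** * Minimal primary decompositions with known points *)

Section Decomposition.
Variables (I : ideal P) (r : nat) (D : 'I_r -> ideal P) (w : 'I_r -> point).
Hypothesis D_min : minimal_primary_decomposition I D.
Hypothesis D_rad : forall i, radical (D i) = vanishing_ideal (w i).

Lemma decomposition_inj : injective w.
Proof.
by case: D_min => _ _ inj _ i j wij; apply: inj; rewrite /= !D_rad wij.
Qed.

Lemma decomposition_root i p : p \in I -> p.@[w i] = 0.
Proof.
case: D_min => _ I_D _ _ Ip; rewrite -[_ = 0]/(vanishing_ideal (w i) p) -D_rad.
by exists 1; rewrite expr1; apply: (I_D p).1.
Qed.

Lemma separating_poly (y : point) :
  exists q : P, q.@[y] = 1 /\ forall j, w j != y -> q \in D j.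
Proof.
have [q qP] : exists q : 'I_r -> P,
    forall j, (q j).@[y] = 1 /\ (w j != y -> q j \in D j).
  apply: (fin_all_exists (P := fun j q => q.@[y] = 1 /\ (w j != y -> q \in D j))).
  move=> j; have [_|wy] := eqVneq (w j) y.
    by exists 1; rewrite meval1.
  have [v wyv] : exists v, w j v != y v.
    apply/existsP; rewrite -negb_forall; apply: contraNN wy => /forallP wy.
    by apply/eqP/ffunP => v; apply/eqP.
  (* An affine function that is 0 at [w j] and 1 at [y]: some power of it lies in [D j] and still
     takes the value 1 at [y]. *)
  pose x : P := (y v - w j v)^-1 *: ('X_v - (w j v)%:A).
  have xE (u : point) : x.@[u] = (y v - w j v)^-1 * (u v - w j v).
    by rewrite mevalZ mevalB mevalXU meval_alg.
  have [k Dk] : radical (D j) x by rewrite D_rad /= /vanishing_ideal /= xE subrr mulr0.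
  exists (x ^+ k); split=> //; rewrite rmorphXn /= xE mulVf ?expr1n //.
  by rewrite subr_eq0 eq_sym.
exists (\prod_j q j); split.
  by rewrite rmorph_prod /= big1 // => j _; have [] := qP j.
by move=> j wj; rewrite (bigD1 j) //= mulrC idealM //; apply: (qP j).2.
Qed.

(** Otherwise the polynomial separating [y] from all the [w j] would lie in [I] without vanishing at
    [y]. *)
Lemma root_decomposition (y : point) :
  (forall p, p \in I -> p.@[y] = 0) -> exists i, w i = y.
Proof.
case: D_min => _ I_D _ _ y_root; have [q [qy qD]] := separating_poly y.
apply: contrapT => wy.
have /y_root/eqP : q \in I.
  by apply/I_D => j; apply: qD; apply/eqP => wj; apply: wy; exists j.
by rewrite qy oner_eq0.
Qed.

(** The right-hand side involves only [I] and [w i], so components of two decompositions at the same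
    point agree. A separating polynomial gives [q]; conversely [q.@[w i] != 0] keeps [q] out of the
    radical. *)
Lemma isolated_componentP i p :
  p \in D i <-> exists q : P, q.@[w i] != 0 /\ q * p \in I.
Proof.
case: D_min => D_prim I_D _ _; split=> [Dp|[q [qw /I_D/(_ i) Dqp]]].
  have [q [qw qD]] := separating_poly (w i).
  exists q; rewrite qw oner_neq0; split=> //; apply/I_D => j.
  have [-> |ji] := eqVneq j i; first exact: idealM.
  by rewrite mulrC idealM // qD // (inj_eq decomposition_inj).
move: Dqp; rewrite mulrC => /(D_prim i).2[//|Dq].
have : vanishing_ideal (w i) q by rewrite -D_rad.
by move=> /eqP; rewrite (negPf qw).
Qed.

Lemma decomposition_idempotent i :
  exists e : P, 1 - e \in D i /\ forall j, j != i -> e \in D j.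
Proof.
have [q [qw qD]] := separating_poly (w i).
have [k Dk] : radical (D i) (1 - q).
  by rewrite D_rad /vanishing_ideal /= mevalB meval1 qw subrr.
(* Its complement [(1 - q) ^+ k] lies in [D i], and it is itself a multiple of [q], hence in every
   other [D j]. *)
exists (1 - (1 - q) ^+ k); split=> [|j ji]; first by rewrite subKr.
rewrite -opprB subrX1 rpredN mulrC idealM // addrAC subrr add0r rpredN.
by rewrite qD // (inj_eq decomposition_inj).
Qed.

End Decomposition.

(** * The trace as a sum over the points *)

Lemma decomposition_points I n (B : 'I_n -> quotient I) r (D : 'I_r -> ideal P) :
    is_basis B -> minimal_primary_decomposition I D ->
  exists w : 'I_r -> point, forall i, radical (D i) = vanishing_ideal (w i).
Proof.
move=> B_basis [D_prim I_D _ _]; 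
apply: (fin_all_exists (P := fun i w => radical (D i) = vanishing_ideal w)) => i.
by apply: (primary_vanishing_ideal B_basis) => // p /I_D.
Qed.

Lemma vanishing_ideal_inj : injective (@vanishing_ideal F m).
Proof.
move=> w y wy; apply/ffunP => v; apply/esym/eqP; rewrite -subr_eq0; apply/eqP.
have : vanishing_ideal w ('X_v - (w v)%:A).
  by rewrite /vanishing_ideal /= mevalB mevalXU meval_alg subrr.
by rewrite wy /vanishing_ideal /= mevalB mevalXU meval_alg.
Qed.

Lemma mxtrace_mult_matrix I n (B : 'I_n -> quotient I) (z : 'I_n -> point) (p : P) :
    is_basis B ->
    (forall k p, p \in I -> p.@[z k] = 0) ->
    (forall w : point, (forall p, p \in I -> p.@[w] = 0) ->
       has_multiplicity I w #|[set k | z k == w]|) ->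
  \tr (mult_matrix B (qproj I p)) = \sum_k p.@[z k].
Proof.
case: n B z => [|n] B z B_basis z_root z_mult.
  by rewrite /mxtrace !big_ord0.
(* The multiplicity hypothesis at one root already supplies a primary decomposition; [n > 0]
   provides the root. *)
have [_ [[r [D [D_min _]]] _ _]] := z_mult _ (z_root ord0).
have [w D_rad] := decomposition_points B_basis D_min.
have w_inj := decomposition_inj D_min D_rad.
have I_D := let: And4 _ h _ _ := D_min in h.
have [e eP] := fin_all_exists (decomposition_idempotent D_min D_rad).
have [s sP] := fin_all_exists (fun k => root_decomposition D_min D_rad (z_root k)).
have tr_e i : \tr (mult_matrix B (qproj I (e i))) = #|[set k | z k == w i]|%:R.
  (* The multiplicity of [w i] may be witnessed in another decomposition [D']; its component is
     shown to equal [D i]. *)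
  have [Q [[r' [D' [D'_min [i' <-{Q}]]]] Q_rad Q_dim]] :=
    z_mult _ (fun q => decomposition_root D_min D_rad i (p := q)).
  have [w' D'_rad] := decomposition_points B_basis D'_min.
  have w'w : w' i' = w i by apply: vanishing_ideal_inj; rewrite -D'_rad.
  have D'D q : q \in D' i' <-> q \in D i.
    rewrite (isolated_componentP D'_min D'_rad) w'w.
    by rewrite (isolated_componentP D_min D_rad).
  have [De De'] := eP i.
  apply: (mxtrace_idempotent B_basis _ _ _ Q_dim).
  - by case: D'_min => _ I_D' _ _ q /I_D'.
  - exact/D'D.
  - move=> q /D'D Dq; apply/I_D => j.
    by have [-> |ji] := eqVneq j i; [rewrite idealM | rewrite mulrC idealM ?De'].
(* Modulo [D j] only [e j] survives in the sum, and it is 1 there. *)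
have I_e : 1 - \sum_i e i \in I.
  apply/I_D => j; rewrite (bigD1 j) //= opprD addrA; apply: rpredB.
    by have [] := eP j.
  by apply: rpred_sum => i ij; apply: (eP i).2; rewrite eq_sym.
have p_e : qproj I p = \sum_i qproj I (p * e i).
  rewrite -raddf_sum -mulr_sumr; apply/qprojP.
  by rewrite -{1}[p]mulr1 -mulrBr idealM.
rewrite p_e (big_morph _ (mult_matrixD B_basis) (mult_matrix0 B_basis)).
(* The roots [z k] are grouped by the index [s k] of their component. *)
rewrite raddf_sum /= (partition_big s predT) //=; apply: eq_bigr => i _.
have -> : p * e i = (p - (p.@[w i])%:A) * e i + p.@[w i] *: e i.
  by rewrite mulrBl mulr_algl subrK.
rewrite raddfD /= qprojZ mult_matrixD // mult_matrixZ // mxtraceD mxtraceZ tr_e.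
rewrite mult_matrix_nilpotent //; last first.
  have [k Dk] : radical (D i) (p - (p.@[w i])%:A).
    by rewrite D_rad /vanishing_ideal /= mevalB meval_alg subrr.
  (* The exponent must be positive, so that the power of [e i] lies in [D j] for [j != i] even when
     [k] is 0. *)
  exists k.+1; apply/I_D => j; rewrite exprMn.
  have [-> |ji] := eqVneq j i; first by rewrite mulrC idealM // exprS idealM.
  by rewrite idealM // ideal_exp // (eP i).2.
rewrite add0r mulr_natr -sumr_const; apply: eq_big => k.
  by rewrite inE -sP (inj_eq w_inj).
by rewrite inE => /eqP ->.
Qed.

End Points.

Theorem proposition3p4 (R : realType) (m l n : nat)
    (f : 'I_l -> {mpoly R[i][m]})
    (f_fin : finite_set (common_roots f))
    (B : 'I_n -> quotient (generated_ideal f))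
    (B_basis : is_basis B)
    (b : 'I_n -> {mpoly R[i][m]})
    (b_lift : forall i, qproj (generated_ideal f) (b i) = B i)
    (z : 'I_n -> {ffun 'I_m -> R[i]})
    (z_root : forall k, common_roots f (z k))
    (z_mult : forall w, common_roots f w ->
       has_multiplicity (generated_ideal f) w #|[set k | z k == w]|) :
  \matrix_(i, j) \tr (mult_matrix B (B i * B j)) =
  \matrix_(i, j) \sum_(k < n) (b i * b j).@[z k].
Proof.
apply/matrixP => i j; rewrite !mxE -!b_lift -rmorphM.
apply: mxtrace_mult_matrix => // [k p|w w_root].
  move=> /asboolP[c ->]; rewrite raddf_sum big1 //= => t _.
  by rewrite mevalM z_root mulr0.
(* A common zero of the ideal is a common root, as each [f t] lies in the ideal with Kronecker delta
   coefficients. *)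
apply: z_mult => t; apply: w_root; apply/asboolP.
exists (fun u => (u == t)%:R); rewrite (bigD1 t) //= eqxx mul1r big1 ?addr0 //.
by move=> u /negPf ->; rewrite mul0r.
Qed.
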